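(* Let $\mathcal{M}$ be the lattice of stable matchings of an instance of the stable marriage problem on the complete bipartite graph $G(M\cup W,E)$, let $\Pi$ be its rotation poset, and let $\mu_0$ be the minimal element of $\mathcal{M}$. Then the stable matching polytope $S(\mathcal{M})$ is affinely equivalent to the order polytope $\mathcal{O}(\Pi)$. More precisely, $$S(\mathcal{M})=\chi^{\mu_0}+A\cdot\mathcal{O}(\Pi),$$ where $A\in\mathbb{R}^{E\times\Pi}$ is the matrix whose column indexed by $\rho=(\rho^-,\rho^+)\in\Pi$ is $A^\rho=\chi^{\rho^+}-\chi^{\rho^-}$.
   Context: Instance: a complete bipartite graph $G(M\cup W,E)$ with $|M|=|W|=n$, and for each vertex $v$ a strict linear order $<_v$ on the neighbors of $v$, where $a<_v b$ means that $v$ prefers $b$ to $a$. A stable matching is a perfect matching $\mu\subseteq E$ such that, writing $\mu(v)$ for the partner of $v$, for every $mw\in E\setminus\mu$ either $m<_w\mu(w)$ or $w<_m\mu(m)$. $\mathcal{M}$ is the set of all stable matchings; it is non-empty. For $F\subseteq E$, $\chi^F\in\{0,1\}^E$ is the characteristic vector of $F$. The stable matching polytope $S(\mathcal{M})\subseteq\mathbb{R}^E$ is the convex hull of $\{\chi^\mu:\mu\in\mathcal{M}\}$. For $\mu,\mu'\in\mathcal{M}$ write $\mu\preceq\mu'$ if for each $w\in W$ either $\mu(w)<_w\mu'(w)$ or $\mu(w)=\mu'(w)$. With this relation $\mathcal{M}$ is a distributive lattice; $\mu_0$ and $\mu_z$ denote its minimum and maximum. An ordered pair $(\mu,\mu')$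 of distinct stable matchings is a covering pair if $\mu\preceq\mu'$ and there is no other $\mu''\in\mathcal{M}$ with $\mu\preceq\mu''\preceq\mu'$. The Hasse diagram $H$ is the directed graph with node set $\mathcal{M}$ whose arcs are the covering pairs. The rotation generated by a covering pair $(\mu,\mu')$ is the pair $\rho=(\rho^-,\rho^+)$ with $\rho^-=\mu\setminus\mu'$ and $\rho^+=\mu'\setminus\mu$. $\Pi$ is the set of all rotations generated by covering pairs (different covering pairs may generate the same rotation). For rotations $\rho,\rho'\in\Pi$, $\rho$ precedes $\rho'$ if in every directed $\mu_0$-$\mu_z$ path in $H$ every arc generating $\rho$ precedes every arc generating $\rho'$; this relation makes $\Pi$ a poset (the rotation poset). For a finite poset $(P,\preceq)$, the order polytope is $\mathcal{O}(P)=\{x\in[0,1]^P: x_i\geq x_j\text{ whenever }i\preceq j\}$. Two polytopes are affinely equivalent if there is an affine map restricting to a bijection from one onto the other. *)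

(* Defs.v *)
From mathcomp Require Import all_boot all_order all_algebra.
From mathcomp Require Import boolp classical_sets functions.

Set Implicit Arguments.
Unset Strict Implicit.
Unset Printing Implicit Defensive.

Import Order.TTheory GRing.Theory Num.Theory.

Local Open Scope classical_set_scope.
Local Open Scope ring_scope.

Definition strict_linear (T : eqType) (r : rel T) : Prop :=
  [/\ irreflexive r, transitive r & forall x y, x != y -> r x y || r y x].

(* The graph is complete bipartite: its edge set is the whole type M * W.
   [ltM I m w w'] means that m prefers w' to w, and [ltW I w m m'] that w
   prefers m' to m (preferences increase from left to right). *)
Record marriage_instance (M W : finType) := MarriageInstance {
  ltM : M -> rel W;
  ltW : W -> rel M;
  ltM_linear : forall m, strict_linear (ltM m);
  ltW_linear : forall w, strict_linear (ltW w);
  card_sides : #|M| = #|W|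
}.

Definition perfect_matching (M W : finType) (mu : {set M * W}) : bool :=
  [forall m, #|[pred w | (m, w) \in mu]| == 1%N]
  && [forall w, #|[pred m | (m, w) \in mu]| == 1%N].

(* Partners are accessed relationally: in a perfect matching the m' with
   (m', w) \in mu is unique, and is the partner mu(w); likewise for men. *)
Definition stable (M W : finType) (I : marriage_instance M W)
    (mu : {set M * W}) : bool :=
  perfect_matching mu
  && [forall m, forall w, ((m, w) \notin mu) ==>
       ([exists m', ((m', w) \in mu) && ltW I w m m']
        || [exists w', ((m, w') \in mu) && ltM I m w w'])].

(* Meaningful for perfect matchings mu and mu'. *)
Definition matching_le (M W : finType) (I : marriage_instance M W)
    (mu mu' : {set M * W}) : bool :=
  [forall w, forall m, forall m', ((m, w) \in mu) && ((m', w) \in mu') ==>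
    (ltW I w m m' || (m == m'))].

Definition is_min_stable (M W : finType) (I : marriage_instance M W)
    (mu0 : {set M * W}) : bool :=
  stable I mu0 && [forall mu, stable I mu ==> matching_le I mu0 mu].

Definition is_max_stable (M W : finType) (I : marriage_instance M W)
    (muz : {set M * W}) : bool :=
  stable I muz && [forall mu, stable I mu ==> matching_le I mu muz].

(* The covering pairs are the arcs of the Hasse diagram. *)
Definition covering (M W : finType) (I : marriage_instance M W)
    (mu mu' : {set M * W}) : bool :=
  [&& stable I mu, stable I mu', mu != mu', matching_le I mu mu' &
    [forall mu'', [&& stable I mu'', matching_le I mu mu''
                    & matching_le I mu'' mu'] ==>
      ((mu'' == mu) || (mu'' == mu'))]].

(* The pair (rho^-, rho^+). *)
Definition generated_rotation (M W : finType) (mu mu' : {set M * W}) :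
    {set M * W} * {set M * W} :=
  (mu :\: mu', mu' :\: mu)%SET.

Definition is_rotation (M W : finType) (I : marriage_instance M W)
    (rho : {set M * W} * {set M * W}) : bool :=
  [exists mu, exists mu',
    covering I mu mu' && (rho == generated_rotation mu mu')].

Definition rotation (M W : finType) (I : marriage_instance M W) : Type :=
  {rho : {set M * W} * {set M * W} | is_rotation I rho}.

(* The i-th arc of the walk mu :: p in the Hasse diagram generates rho. *)
Definition arc_generates (M W : finType) (I : marriage_instance M W)
    (mu : {set M * W}) (p : seq {set M * W}) (i : nat) (rho : rotation I) :
    bool :=
  (i < size p)%N
  && (generated_rotation (nth mu (mu :: p) i) (nth mu (mu :: p) i.+1)
      == val rho).

Definition precedes (M W : finType) (I : marriage_instance M W)
    (rho rho' : rotation I) : Prop :=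
  forall (mu0 muz : {set M * W}) (p : seq {set M * W}),
    is_min_stable I mu0 -> is_max_stable I muz ->
    path (covering I) mu0 p -> last mu0 p = muz ->
    forall i j, arc_generates mu0 p i rho -> arc_generates mu0 p j rho' ->
      (i < j)%N.

(* The order of the rotation poset is the reflexive closure of [precedes]. *)
Definition rotation_le (M W : finType) (I : marriage_instance M W)
    (rho rho' : rotation I) : Prop :=
  rho = rho' \/ precedes rho rho'.

Arguments rotation_le [M W] I rho rho'.

Definition convex_hull (R : realFieldType) (V : lmodType R) (X : set V) :
    set V :=
  [set v | exists (k : nat) (l : 'I_k -> R) (x : 'I_k -> V),
     [/\ forall i, 0 <= l i, \sum_i l i = 1, forall i, X (x i)
       & v = \sum_i l i *: x i]].

Definition order_polytope (R : realFieldType) (P : finType)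
    (le : P -> P -> Prop) : set {ffun P -> R^o} :=
  [set x : {ffun P -> R^o} |
    (forall i, 0 <= x i <= 1) /\ (forall i j, le i j -> x j <= x i)].

Arguments order_polytope R [P] le.

Definition affine_map (R : realFieldType) (U V : lmodType R) (f : U -> V) :
    Prop :=
  exists (g : {linear U -> V}) (b : V), forall u, f u = b + g u.

Definition affinely_equivalent (R : realFieldType) (U V : lmodType R)
    (P : set U) (Q : set V) : Prop :=
  exists2 f : U -> V, affine_map f & set_bij P Q f.

(* The coordinate space is {ffun _ -> R^o}: the lmodType structure of finite
   functions needs the codomain to be a module, hence R^o rather than R. *)
Definition char_vec (R : realFieldType) (E : finType) (F : {set E}) :
    {ffun E -> R^o} :=
  [ffun e => (e \in F)%:R].

Definition stable_matching_polytope (R : realFieldType) (M W : finType)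
    (I : marriage_instance M W) : set {ffun M * W -> R^o} :=
  convex_hull [set char_vec R mu | mu in [set mu | stable I mu]].

Arguments stable_matching_polytope R [M W] I.

(* The E x Pi matrix A, as a function of its row and column indices. *)
Definition rotation_matrix (R : realFieldType) (M W : finType)
    (I : marriage_instance M W) (e : M * W) (rho : rotation I) : R :=
  (char_vec R (val rho).2 - char_vec R (val rho).1) e.

Arguments rotation_matrix R [M W] I e rho.

Definition matrix_apply (R : realFieldType) (E P : finType) (A : E -> P -> R)
    (x : {ffun P -> R^o}) : {ffun E -> R^o} :=
  [ffun e => \sum_rho A e rho * x rho].

(* Main.v *)
Require Import Defs.
From HB Require Import structures.
From mathcomp Require Import boolp classical_sets functions.
From mathcomp Require Import all_boot all_order all_algebra.

Set Implicit Arguments.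
Unset Strict Implicit.
Unset Printing Implicit Defensive.

Import Order.TTheory GRing.Theory Num.Theory.

(** A stable matching mu is recorded by its lower set: the edges (m, w) such
    that w likes m at most as much as her partner.  Giving every woman the
    better, or the worse, of her partners in two stable matchings yields a
    stable matching again ([join_stable], [meet_stable]), and on lower sets
    these operations are union and intersection.  The stable matchings thus
    form a ring of sets, which is not empty by [stable_assignment_exists].

    Along a covering pair (mu, nu) the lower set gains the difference
    [lower nu :\: lower mu].  In a ring of sets, the members contain such a
    difference entirely or not at all ([covering_gain]), so that two of them
    are equal or disjoint.  Here the difference determines the rotation and
    conversely ([gain_generated], [gain_inj]): a woman who moves from a to b
    gains the interval ]a, b] of her list, and the interval determines its
    ends.  Hence a stable matching is described by the set of rotations below
    it, a path in the Hasse diagram generates exactly once each rotation below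
    its end but not below its origin, and the sets of rotations below stable
    matchings are exactly the sets closed under predecessors
    ([rotations_below_closed], [closed_rotations_below]).

    Let h x be the characteristic vector of mu0 plus A x.  Adding up the arcs of
    a path from mu0 to mu shows that h sends the indicator of the rotations
    below mu to the characteristic vector of mu ([char_vec_rotations]).
    Conversely, choose an edge (m, w) in the gain of each rotation rho; then
    rho is below mu if and only if (m, w) is in the lower set of mu, that is,
    if mu contains one of the edges at w that w likes at least as much as
    (m, w).  Summing the coordinates over these edges is therefore a linear map
    inverse to h on these points ([threshold_char_vec]).  Finally, the order
    polytope is the convex hull of the indicators of the closed sets
    ([order_polytope_hull]), so that h and the linear map are mutually inverse
    bijections between the two convex hulls ([convex_hull_bij]). *)

Local Open Scope set_scope.

(** * Strict linear orders *)

Definition weak (T : eqType) (r : rel T) : rel T :=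
  fun x y => (x == y) || r x y.

Section StrictLinear.

Variables (T : eqType) (r : rel T).
Hypothesis r_lin : strict_linear r.

Lemma slin_irr x : r x x = false.
Proof. by case: r_lin => irr _ _; apply: irr. Qed.

Lemma slin_trans : transitive r.
Proof. by case: r_lin. Qed.

Lemma slin_asym x y : r x y -> r y x = false.
Proof.
by move=> rxy; apply/negP => /(slin_trans rxy); rewrite slin_irr.
Qed.

Lemma weak_refl x : weak r x x.
Proof. by rewrite /weak eqxx. Qed.

Lemma weakW x y : r x y -> weak r x y.
Proof. by rewrite /weak orbC => ->. Qed.

Lemma weakN x y : ~~ weak r x y = r y x.
Proof.
case: r_lin => _ _ tot; rewrite /weak negb_or.
have [->|neq_xy] /= := eqVneq x y; first by rewrite slin_irr.
by have /orP[rxy|ryx] := tot _ _ neq_xy;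
  rewrite ?rxy ?ryx ?(slin_asym rxy) ?(slin_asym ryx).
Qed.

Lemma slinN x y : ~~ r x y = weak r y x.
Proof. by rewrite -weakN negbK. Qed.

Lemma weak_slin_trans x y z : weak r x y -> r y z -> r x z.
Proof. by case/orP=> [/eqP-> //|]; apply: slin_trans. Qed.

Lemma slin_weak_trans x y z : r x y -> weak r y z -> r x z.
Proof. by move=> rxy /orP[/eqP<- //|]; apply: slin_trans. Qed.

Lemma weak_trans x y z : weak r x y -> weak r y z -> weak r x z.
Proof.
by move=> wxy /orP[/eqP<- //|ryz]; apply/weakW/(weak_slin_trans wxy ryz).
Qed.

Lemma weak_anti x y : weak r x y -> weak r y x -> x = y.
Proof.
by case/orP=> [/eqP->//|rxy] /orP[/eqP->//|]; rewrite (slin_asym rxy).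
Qed.

Lemma weak_neq x y : weak r x y -> x != y -> r x y.
Proof. by case/orP=> [/eqP->|//]; rewrite eqxx. Qed.

End StrictLinear.

Lemma ex_slin_top (T : finType) (r : rel T) (P : pred T) x :
    strict_linear r -> P x ->
  exists2 y, P y & forall z, P z -> weak r z y.
Proof.
move=> r_lin Px; case: (@arg_maxnP T x P (fun y => #|[pred z | r z y]|) Px).
move=> y Py max_y; exists y => // z Pz; apply: contraT; rewrite weakN // => ryz.
suff: #|[pred t | r t y]| < #|[pred t | r t z]|.
  by move=> /leq_trans/(_ (max_y z Pz)); rewrite ltnn.
apply/proper_card/properP; split.
  by apply/subsetP => t; rewrite !inE => /(slin_trans r_lin)->.
by exists y; rewrite inE ?slin_irr.
Qed.

(** * Stable matchings as functions on the women *)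

Section StableAssignments.

Variables (M W : finType) (I : marriage_instance M W).

Implicit Types (f g : {ffun W -> M}) (w : W) (m : M) (mu nu : {set M * W}).

Local Notation ltW := (Defs.ltW I).
Local Notation ltM := (Defs.ltM I).
Local Notation leW w := (weak (ltW w)).
Local Notation leM m := (weak (ltM m)).
Local Notation linW := (ltW_linear I).
Local Notation linM := (ltM_linear I).

(** A matching as the function sending a woman to her partner.  The second
    clause is the absence of a blocking pair (f w', w): as the sides have equal
    cardinals, every man has the form f w', so that all men are covered. *)
Definition stable_assignment f : Prop :=
  injective f /\ forall w w', ltW w (f w) (f w') -> ltM (f w') w w'.

Definition graph f : {set M * W} := [set e | f e.2 == e.1].

Lemma injective_assignment_surj f m : injective f -> exists w, f w = m.
Proof.
move=> inj_f; have := inj_card_onto inj_f _ m.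
by rewrite -(card_sides I) leqnn => /(_ isT)/codomP[w ->]; exists w.
Qed.

Lemma stable_graph f : stable_assignment f -> stable I (graph f).
Proof.
case=> inj_f st_f; apply/andP; split.
  apply/andP; split; apply/forallP => x.
    have [w <-] := injective_assignment_surj x inj_f.
    apply/eqP; rewrite -(card1 w); apply: eq_card => w'.
    by rewrite !inE /= (inj_eq inj_f).
  apply/eqP; rewrite -(card1 (f x)); apply: eq_card => m.
  by rewrite !inE /= eq_sym.
apply/forallP => m; apply/forallP => w; apply/implyP; rewrite inE /= => neq_m.
have [w' def_m] := injective_assignment_surj m inj_f.
apply/orP; have [lt_m|] := boolP (ltW w m (f w)).
  by left; apply/existsP; exists (f w); rewrite inE eqxx.
rewrite (slinN (linW w)) => /weak_neq/(_ neq_m); rewrite -{1}def_m => /st_f.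
by rewrite def_m => lt_w; right; apply/existsP; exists w'; rewrite inE /= def_m eqxx.
Qed.

Lemma stable_graphP mu :
  stable I mu -> exists2 f, stable_assignment f & mu = graph f.
Proof.
case/andP=> /andP[/forallP perfM /forallP perfW] st_mu.
have /fin_all_exists[f0 f0P] w :
    exists m, forall m', ((m', w) \in mu) = (m' == m).
  have /pred0Pn[m mu_m] : #|[pred m | (m, w) \in mu]| != 0%N.
    by rewrite (eqP (perfW w)).
  exists m => m'; have /card_le1P/(_ m mu_m m') := eq_leq (eqP (perfW w)).
  by rewrite !inE.
pose f : {ffun W -> M} := finfun f0.
have fP m w : ((m, w) \in mu) = (f w == m) by rewrite f0P ffunE eq_sym.
exists f; last by apply/setP => -[m w]; rewrite inE fP.
have inj_f : injective f.
  move=> w w' eq_f; have mu_w : w \in [pred v | (f w, v) \in mu] by rewrite inE fP.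
  have /card_le1P/(_ w mu_w w') := eq_leq (eqP (perfM (f w))).
  by rewrite !inE fP eq_f eqxx => /esym/eqP->.
split=> // w w' lt_f; move/forallP/(_ (f w'))/forallP/(_ w): st_mu.
have -> /= : (f w', w) \notin mu.
  by rewrite fP; apply/negP => /eqP eq_f; rewrite eq_f (slin_irr (linW w)) in lt_f.
case/orP=> /existsP[x /andP[]].
  by rewrite fP => /eqP<-; rewrite (slin_asym (linW w) lt_f).
by rewrite fP (inj_eq inj_f) => /eqP->.
Qed.

(** In the fixed-point formulation of deferred acceptance, A is a set of edges
    open to the men and B a set of edges open to the women; each side rejects
    the edges that it can improve on inside its set, and an edge is open to
    one side unless the other side rejects it. *)
Definition rejectM (A : {set M * W}) : {set M * W} :=
  [set e in A | [exists w, ((e.1, w) \in A) && ltM e.1 e.2 w]].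

Definition rejectW (B : {set M * W}) : {set M * W} :=
  [set e in B | [exists m, ((m, e.2) \in B) && ltW e.2 e.1 m]].

Lemma rejectM_mono (A B : {set M * W}) :
  A \subset B -> rejectM A \subset rejectM B.
Proof.
move=> /subsetP sAB; apply/subsetP => e; rewrite !inE => /andP[/sAB-> /=].
case/existsP=> w /andP[/sAB Bw lt_w]; apply/existsP; exists w.
by rewrite Bw.
Qed.

Lemma rejectW_mono (A B : {set M * W}) :
  A \subset B -> rejectW A \subset rejectW B.
Proof.
move=> /subsetP sAB; apply/subsetP => e; rewrite !inE => /andP[/sAB-> /=].
case/existsP=> m /andP[/sAB Bm lt_m]; apply/existsP; exists m.
by rewrite Bm.
Qed.

(** Gale and Shapley's theorem.  The map sending A to the complement of the
    women's rejections from the complement of the men's rejections from A is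
    monotone; at a fixed point the edges open to both sides form a stable
    matching. *)
Lemma stable_assignment_exists : exists f, stable_assignment f.
Proof.
pose F (A : {set M * W}) := ~: rejectW (~: rejectM A).
have monoF : {homo F : A B / A \subset B}.
  move=> A B sAB; rewrite /F setCS; apply: rejectW_mono.
  by rewrite setCS; apply: rejectM_mono.
pose A := fixset F; pose B := ~: rejectM A.
have defA : A = ~: rejectW B by rewrite -[LHS](fixsetK monoF).
have inB e : (e \in B) = (e \notin rejectM A) by rewrite inE.
have inA e : (e \in A) = (e \notin rejectW B) by rewrite {1}defA inE.
have topA m w : (m, w) \in A ->
    exists2 w', (m, w') \in A :&: B & leM m w w'.
  move=> Aw; have [] := @ex_slin_top _ _ [pred v | (m, v) \in A] w (linM m) Aw.
  move=> w' /= Aw' top; exists w'; last exact: top.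
  rewrite in_setI Aw' inB inE Aw'; apply/existsP => -[v /andP[/top le_v]].
  by rewrite /= -(weakN (linM m)) le_v.
have topB m w : (m, w) \in B ->
    exists2 m', (m', w) \in A :&: B & leW w m m'.
  move=> Bm; have [] := @ex_slin_top _ _ [pred v | (v, w) \in B] m (linW w) Bm.
  move=> m' /= Bm' top; exists m'; last exact: top.
  rewrite in_setI Bm' inA [_ \in rejectW _]inE Bm' andbT.
  apply/existsP => -[v /andP[/top le_v]].
  by rewrite /= -(weakN (linW w)) le_v.
have outA m w : (m, w) \notin A ->
    exists2 m', (m', w) \in A :&: B & ltW w m m'.
  rewrite inA negbK inE => /andP[_ /existsP[m1 /andP[/topB[m' ABm' le_m] lt_m]]].
  by exists m' => //; apply: (slin_weak_trans (linW w)) lt_m le_m.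
have uniqW m w w' : (m, w) \in A :&: B -> (m, w') \in A :&: B -> w = w'.
  have le_AB v v' : (m, v) \in A :&: B -> (m, v') \in A -> leM m v' v.
    rewrite in_setI inB inE => /andP[-> /existsPn/(_ v')] nlt Av'.
    by move: nlt; rewrite Av' (slinN (linM m)).
  move=> ABw ABw'; apply: (weak_anti (linM m)); apply: le_AB => //.
    by case/setIP: ABw.
  by case/setIP: ABw'.
have uniqM m m' w : (m, w) \in A :&: B -> (m', w) \in A :&: B -> m = m'.
  have le_AB v v' : (v, w) \in A :&: B -> (v', w) \in B -> leW w v' v.
    rewrite in_setI inA [_ \in rejectW _]inE => /andP[+ Bv] Bv'.
    by rewrite Bv /= => /existsPn/(_ v'); rewrite Bv' (slinN (linW w)).
  move=> ABm ABm'; apply: (weak_anti (linW w)); apply: le_AB => //.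
    by case/setIP: ABm.
  by case/setIP: ABm'.
have matched w : exists m, (m, w) \in A :&: B.
  have [/existsP//|/existsPn unmatched] := boolP [exists m, (m, w) \in A :&: B].
  (* If w were unmatched, every edge at w would be open to the men, so every
     man would be matched; the sides having equal cardinals, so would w. *)
  have /fin_all_exists[h hP] m : exists w', (m, w') \in A :&: B.
    have Aw : (m, w) \in A.
      by apply: contraT => /outA[m' ABm']; have := unmatched m'; rewrite ABm'.
    by have [w' ABw' _] := topA _ _ Aw; exists w'.
  have inj_h : injective h.
    by move=> m m' eq_h; apply: (uniqM _ _ (h m)); rewrite // eq_h.
  have := inj_card_onto inj_h _ w; rewrite (card_sides I) leqnn.
  by case/(_ isT)/codomP=> m def_w; exists m; rewrite def_w.
have /fin_all_exists[f0 f0P] := matched.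
pose f : {ffun W -> M} := finfun f0.
have fP w : (f w, w) \in A :&: B by rewrite ffunE.
exists f; split=> [w w' eq_f | w w' lt_f].
  by apply: (uniqW (f w)); rewrite // eq_f.
have Aw : (f w', w) \in A.
  apply: contraT => /outA[m ABm]; rewrite (uniqM _ _ _ ABm (fP w)).
  by rewrite (slin_asym (linW w) lt_f).
have [v ABv] := topA _ _ Aw; rewrite (uniqW _ _ _ ABv (fP w')).
case/orP=> [/eqP eq_w|//].
by rewrite eq_w (slin_irr (linW w')) in lt_f.
Qed.

Definition join f g : {ffun W -> M} :=
  [ffun w => if leW w (f w) (g w) then g w else f w].

Definition meet f g : {ffun W -> M} :=
  [ffun w => if leW w (f w) (g w) then f w else g w].

Variant join_meet_spec f g w : M -> M -> Prop :=
  | JoinMeetLe of leW w (f w) (g w) : join_meet_spec f g w (g w) (f w)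
  | JoinMeetGe of leW w (g w) (f w) : join_meet_spec f g w (f w) (g w).

Lemma join_meetP f g w : join_meet_spec f g w (join f g w) (meet f g w).
Proof.
rewrite !ffunE; case: ifPn => [le_fg|]; first by constructor.
by rewrite (weakN (linW w)) => /weakW; constructor.
Qed.

(** If w and w' both received the same man m in the join, one from f and the
    other from g, then each would prefer m to her other partner, and
    stability of f and g would make m prefer each of the two women to the
    other. *)
Lemma join_injective f g :
  stable_assignment f -> stable_assignment g -> injective (join f g).
Proof.
move=> [inj_f st_f] [inj_g st_g].
suff crossed w w' : f w = g w' -> leW w (g w) (f w) -> leW w' (f w') (g w') ->
    w = w'.
  move=> w w'; case: join_meetP => le_w; case: join_meetP => le_w'.
  - exact: inj_g.
  - by move/esym => eq_m; apply/esym/(crossed w' w).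
  - by move=> eq_m; apply: (crossed w w').
  - exact: inj_f.
move=> eq_m le_w le_w'; have [//|neq_w] := eqVneq w w'.
have lt_w : ltW w (g w) (g w').
  by rewrite -eq_m weak_neq // eq_m (inj_eq inj_g).
have lt_w' : ltW w' (f w') (f w).
  by rewrite eq_m weak_neq // -eq_m (inj_eq inj_f) eq_sym.
move/st_g: lt_w; move/st_f: lt_w'; rewrite eq_m => lt_w'w.
by rewrite (slin_asym (linM (g w')) lt_w'w).
Qed.

Lemma join_stable f g :
  stable_assignment f -> stable_assignment g -> stable_assignment (join f g).
Proof.
move=> st_f st_g; split; first exact: join_injective.
case: st_f st_g => [_ st_f] [_ st_g] w w'.
have le_join : leW w (f w) (join f g w) /\ leW w (g w) (join f g w).
  by case: join_meetP => le_w; split=> //; apply: weak_refl.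
case: (join_meetP f g w') => le_w' lt_w.
  by case: le_join => _ le_g; apply/st_g/(weak_slin_trans (linW w) le_g).
by case: le_join => le_f _; apply/st_f/(weak_slin_trans (linW w) le_f).
Qed.

(** The join takes one of the two partners of each man; if the meet gave m to
    two women, it would leave no partner of m for the join. *)
Lemma meet_injective f g :
  stable_assignment f -> stable_assignment g -> injective (meet f g).
Proof.
move=> st_f st_g; have inj_j := join_injective st_f st_g.
case: st_f st_g => [inj_f _] [inj_g _].
suff crossed w w' : f w = g w' -> leW w (f w) (g w) -> leW w' (g w') (f w') ->
    w = w'.
  move=> w w'; case: join_meetP => le_w; case: join_meetP => le_w'.
  - exact: inj_f.
  - by move=> eq_m; apply: (crossed w w').
  - by move/esym => eq_m; apply/esym/(crossed w' w).
  - exact: inj_g.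
move=> eq_m le_w le_w'.
have [u] := injective_assignment_surj (f w) inj_j.
case: join_meetP => le_u eq_u.
  have eq_uw' : u = w' by apply: inj_g; rewrite eq_u.
  rewrite eq_uw' in le_u eq_u; apply: inj_f; rewrite eq_m.
  exact: (weak_anti (linW w')) le_w' le_u.
have eq_uw : u = w by apply: inj_f.
rewrite eq_uw in le_u; apply: inj_g; rewrite -eq_m.
exact: (weak_anti (linW w)) le_u le_w.
Qed.

(** The critical case is that w' receives her man m in the meet from f and w
    receives hers from g.  Let u be the woman with g u = m: stability of g
    makes m prefer u to w.  If u is not w', then the meet, being injective,
    gives u her partner in f, and stability of f makes m prefer w' to u. *)
Lemma meet_stable f g :
  stable_assignment f -> stable_assignment g -> stable_assignment (meet f g).
Proof.
move=> st_f st_g; split; first exact: meet_injective.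
suff crossed f1 g1 w w' : stable_assignment f1 -> stable_assignment g1 ->
    injective (meet f1 g1) -> leW w' (f1 w') (g1 w') ->
    ltW w (g1 w) (f1 w') -> ltM (f1 w') w w'.
  move=> w w'; case: (join_meetP f g w) => _; case: (join_meetP f g w') => le_w'.
  - by case: st_f => _; apply.
  - by apply: crossed => //; apply: meet_injective.
  - by apply: crossed => //; apply: meet_injective.
  - by case: st_g => _; apply.
move=> [_ st_f1] [inj_g1 st_g1] inj_meet le_w' lt_w.
have [u eq_u] := injective_assignment_surj (f1 w') inj_g1.
rewrite -{1}eq_u in lt_w; have := st_g1 _ _ lt_w; rewrite eq_u => lt_wu.
have [eq_uw'|neq_u] := eqVneq u w'; first by rewrite -[in X in ltM _ _ X]eq_uw'.
apply: (slin_trans (linM _) lt_wu); apply: st_f1; rewrite -eq_u.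
rewrite -(weakN (linW u)); apply: contra neq_u => ge_u; apply/eqP/inj_meet.
rewrite !ffunE le_w'; case: ifP => // le_u; rewrite -eq_u.
exact: (weak_anti (linW u)) le_u ge_u.
Qed.

End StableAssignments.

(** * Stable matchings as a ring of sets *)

Section RingOfSets.

Variables (M W : finType) (I : marriage_instance M W).

Implicit Types (f g : {ffun W -> M}) (w : W) (m : M) (mu nu : {set M * W}).
Implicit Types (e : M * W) (r : {set M * W} * {set M * W}) (rho : rotation I).

Local Notation ltW := (Defs.ltW I).
Local Notation leW w := (weak (ltW w)).
Local Notation linW := (ltW_linear I).

(** Recording a matching by all the edges that the women like at most as much
    as their partners turns join and meet into union and intersection. *)
Definition lower mu : {set M * W} :=
  [set e | [exists m, ((m, e.2) \in mu) && leW e.2 e.1 m]].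

Lemma in_lower_graph f e : (e \in lower (graph f)) = leW e.2 e.1 (f e.2).
Proof.
rewrite inE; apply/existsP/idP => [[m]|le_e]; last first.
  by exists (f e.2); rewrite inE eqxx.
by rewrite inE /= => /andP[/eqP->].
Qed.

Lemma lower_join f g :
  lower (graph (join I f g)) = lower (graph f) :|: lower (graph g).
Proof.
apply/setP => e; rewrite in_setU !in_lower_graph.
case: join_meetP => le_e; last rewrite orbC; apply/idP/orP => [|[]]; auto;
  by move=> /(weak_trans (linW _))->.
Qed.

Lemma lower_meet f g :
  lower (graph (meet I f g)) = lower (graph f) :&: lower (graph g).
Proof.
apply/setP => e; rewrite in_setI !in_lower_graph.
case: join_meetP => le_e; last rewrite andbC; apply/idP/andP => [le_e1|[]] //;
  by split=> //; apply: (weak_trans (linW _)) le_e1 le_e.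
Qed.

Lemma stable_join mu nu : stable I mu -> stable I nu ->
  exists2 la, stable I la & lower la = lower mu :|: lower nu.
Proof.
move=> /stable_graphP[f st_f ->] /stable_graphP[g st_g ->].
exists (graph (join I f g)); last exact: lower_join.
exact/stable_graph/join_stable.
Qed.

Lemma stable_meet mu nu : stable I mu -> stable I nu ->
  exists2 la, stable I la & lower la = lower mu :&: lower nu.
Proof.
move=> /stable_graphP[f st_f ->] /stable_graphP[g st_g ->].
exists (graph (meet I f g)); last exact: lower_meet.
exact/stable_graph/meet_stable.
Qed.

Lemma stable_bigjoin mu (s : seq {set M * W}) :
    stable I mu -> all (stable I) s ->
  exists2 la, stable I la &
    forall e, (e \in lower la) = has (fun nu => e \in lower nu) (mu :: s).
Proof.
elim: s mu => [|nu s IHs] mu st_mu /= => [_|/andP[st_nu st_s]].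
  by exists mu => // e; rewrite orbF.
have [mu' st_mu' low_mu'] := stable_join st_mu st_nu.
have [la st_la low_la] := IHs _ st_mu' st_s.
by exists la => // e; rewrite low_la /= low_mu' in_setU orbA.
Qed.

Lemma matching_leE mu nu : stable I mu -> stable I nu ->
  matching_le I mu nu = (lower mu \subset lower nu).
Proof.
move=> /stable_graphP[f st_f ->] /stable_graphP[g st_g ->].
apply/idP/subsetP => [|low_fg].
  move/forallP => le_fg e; rewrite !in_lower_graph => le_e.
  move/(_ e.2)/forallP/(_ (f e.2))/forallP/(_ (g e.2)): le_fg.
  by rewrite !inE !eqxx /= orbC; apply: (weak_trans (linW _)) le_e.
apply/forallP => w; apply/forallP => m; apply/forallP => m'; apply/implyP.
rewrite !inE orbC => /andP[/eqP/= <- /eqP/= <-].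
by have := low_fg (f w, w); rewrite !in_lower_graph; apply; apply: weak_refl.
Qed.

Lemma lower_inj mu nu :
  stable I mu -> stable I nu -> lower mu = lower nu -> mu = nu.
Proof.
move=> /stable_graphP[f st_f ->] /stable_graphP[g st_g ->] /setP low_fg.
suff -> : f = g by [].
apply/ffunP => w; apply: (weak_anti (linW w)).
  by have := low_fg (f w, w); rewrite !in_lower_graph /= weak_refl => <-.
by have := low_fg (g w, w); rewrite !in_lower_graph /= weak_refl.
Qed.

Lemma stable_min_exists : exists mu0, is_min_stable I mu0.
Proof.
have [f /stable_graph st_f] := stable_assignment_exists I.
case: (@arg_minnP _ _ (stable I) (fun mu => #|lower mu|) st_f) => mu st_mu min_mu.
exists mu; rewrite /is_min_stable st_mu; apply/forallP => nu; apply/implyP => st_nu.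
have [la st_la low_la] := stable_meet st_mu st_nu.
rewrite matching_leE //; apply/setIidPl/eqP.
by rewrite eqEcard subsetIl -low_la min_mu.
Qed.

Lemma stable_max_exists : exists muz, is_max_stable I muz.
Proof.
have [f /stable_graph st_f] := stable_assignment_exists I.
case: (@arg_maxnP _ _ (stable I) (fun mu => #|lower mu|) st_f) => mu st_mu max_mu.
exists mu; rewrite /is_max_stable st_mu; apply/forallP => nu; apply/implyP => st_nu.
have [la st_la low_la] := stable_join st_mu st_nu.
rewrite matching_leE //; apply/setUidPl/eqP.
by rewrite eq_sym eqEcard subsetUl -low_la; apply: max_mu.
Qed.

Lemma min_stableP mu0 : is_min_stable I mu0 ->
  stable I mu0 /\ forall mu, stable I mu -> lower mu0 \subset lower mu.
Proof.
case/andP=> st_mu0 /forallP min_mu0; split=> // mu st_mu.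
by rewrite -matching_leE // (implyP (min_mu0 mu)).
Qed.

Lemma max_stableP muz : is_max_stable I muz ->
  stable I muz /\ forall mu, stable I mu -> lower mu \subset lower muz.
Proof.
case/andP=> st_muz /forallP max_muz; split=> // mu st_mu.
by rewrite -matching_leE // (implyP (max_muz mu)).
Qed.

Lemma coveringP mu nu : reflect
  [/\ stable I mu, stable I nu, lower mu \proper lower nu &
      forall la, stable I la -> lower mu \subset lower la ->
        lower la \subset lower nu -> la = mu \/ la = nu]
  (covering I mu nu).
Proof.
apply: (iffP and5P) => -[st_mu st_nu].
  rewrite matching_leE // => neq_mn le_mn /forallP cov; split=> //.
    rewrite properEneq le_mn andbT; apply: contra neq_mn => /eqP low_mn.
    by apply/eqP/lower_inj.
  move=> la st_la le_ml le_ln; move/implyP: (cov la); rewrite st_la.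
  by rewrite !matching_leE // le_ml le_ln => /(_ isT)/orP[]/eqP; auto.
rewrite properEneq => /andP[neq_mn le_mn] cov.
rewrite st_mu st_nu matching_leE //; split=> //.
  by apply: contra neq_mn => /eqP->.
apply/forallP => la; apply/implyP => /and3P[st_la].
rewrite !matching_leE // => le_ml le_ln.
by have [->|->] := cov _ st_la le_ml le_ln; rewrite eqxx ?orbT.
Qed.

(** For a stable la, the union of lower mu with the intersection of lower la
    and lower nu is the lower set of a stable matching.  That matching lies
    between mu and nu, so that it is mu or nu. *)
Lemma covering_gain mu nu la : covering I mu nu -> stable I la ->
  lower nu :\: lower mu \subset lower la
  \/ [disjoint lower nu :\: lower mu & lower la].
Proof.
case/coveringP=> st_mu st_nu /proper_sub le_mn cov st_la.
have [ka st_ka low_ka] := stable_meet st_la st_nu.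
have [ja st_ja low_ja] := stable_join st_ka st_mu.
have le_mj : lower mu \subset lower ja by rewrite low_ja subsetUr.
have le_jn : lower ja \subset lower nu.
  by rewrite low_ja low_ka subUset le_mn andbT subsetIr.
have in_ja e : e \in lower ja =
    ((e \in lower la) && (e \in lower nu)) || (e \in lower mu).
  by rewrite low_ja low_ka in_setU in_setI.
have [eq_j|eq_j] := cov _ st_ja le_mj le_jn; rewrite eq_j in in_ja.
  right; apply/pred0P => e /=; apply/negP; rewrite in_setD => /andP[/andP[+ nu_e] la_e].
  by rewrite in_ja la_e nu_e.
left; apply/subsetP => e; rewrite in_setD => /andP[mu'e].
by rewrite in_ja (negPf mu'e) orbF => /andP[].
Qed.

(** The lower sets of the two ends of a covering pair differ by this set, which
    only depends on the rotation: a rotation moves w from her partner a in its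
    first component to her partner b in the second one, and w gains the
    interval ]a, b] of her preference list. *)
Definition gain r : {set M * W} :=
  [set e | [exists a, exists b, [&& (a, e.2) \in r.1, (b, e.2) \in r.2,
                                 ltW e.2 a e.1 & leW e.2 e.1 b]]].

Lemma gain_generated mu nu : covering I mu nu ->
  gain (generated_rotation mu nu) = lower nu :\: lower mu.
Proof.
case/coveringP=> /stable_graphP[f st_f ->] /stable_graphP[g st_g ->] _ _.
apply/setP => -[m w]; rewrite in_setD !in_lower_graph (weakN (linW w)) inE /=.
apply/existsP/andP => [[a /existsP[b /and4P[]]]|[lt_m le_m]].
  by rewrite !inE /= => /andP[_ /eqP->] /andP[_ /eqP->].
exists (f w); apply/existsP; exists (g w).
rewrite !inE !eqxx !andbT lt_m le_m (eq_sym (g w)) /= !andbT andbb.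
apply: contraTneq lt_m => eq_fg; rewrite eq_fg.
by rewrite -(weakN (linW w)) le_m.
Qed.

Lemma rotationP r :
  reflect (exists mu nu, covering I mu nu /\ r = generated_rotation mu nu)
          (is_rotation I r).
Proof.
apply: (iffP existsP) => [[mu /existsP[nu /andP[cov /eqP->]]]|[mu [nu [cov ->]]]].
  by exists mu, nu.
by exists mu; apply/existsP; exists nu; rewrite cov eqxx.
Qed.

Lemma gain_neq0 r : is_rotation I r -> gain r != set0.
Proof.
case/rotationP=> mu [nu [cov ->]]; rewrite gain_generated //.
by rewrite setD_eq0; case/coveringP: cov => _ _ /properP[_ [e nu_e mu'e]] _;
  apply/subsetPn; exists e.
Qed.

(** The gain at w is an interval ]a, b] of the preference list of w; when it is
    not empty it determines a and b, which are the partners of w in the two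
    components. *)
Lemma gain_inj r r' :
  is_rotation I r -> is_rotation I r' -> gain r = gain r' -> r = r'.
Proof.
suff ends r1 r2 : is_rotation I r1 -> is_rotation I r2 -> gain r1 = gain r2 ->
    r1.1 \subset r2.1 /\ r1.2 \subset r2.2.
  move=> rot_r rot_r' eq_g.
  have [s1 s2] := ends _ _ rot_r rot_r' eq_g.
  have [s1' s2'] := ends _ _ rot_r' rot_r (esym eq_g).
  case: r r' s1 s2 s1' s2' {rot_r rot_r' eq_g} => [a b] [a' b'] /= s1 s2 s1' s2'.
  by congr (_, _); apply/eqP; rewrite eqEsubset ?s1 ?s2.
have gainE f g : covering I (graph f) (graph g) ->
    forall w, leW w (f w) (g w) /\
    forall m, ((m, w) \in gain (generated_rotation (graph f) (graph g))) =
              ltW w (f w) m && leW w m (g w).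
  move=> cov w; split=> [|m].
    case/coveringP: cov => _ _ /proper_sub/subsetP/(_ (f w, w)) + _.
    by rewrite !in_lower_graph; apply; apply: weak_refl.
  by rewrite gain_generated // in_setD !in_lower_graph (weakN (linW w)).
case/rotationP=> mu [nu [cov ->]] /rotationP[mu' [nu' [cov' ->]]].
have [/stable_graphP[f st_f def_mu] /stable_graphP[g st_g def_nu] _ _] :=
  coveringP _ _ cov.
have [/stable_graphP[f' st_f' def_mu'] /stable_graphP[g' st_g' def_nu'] _ _] :=
  coveringP _ _ cov'.
subst mu nu mu' nu' => /setP eq_g.
suff same w : f w != g w -> f' w = f w /\ g' w = g w.
  split; apply/subsetP => -[m w]; rewrite !inE /=.
    case/andP=> + /eqP eq_m; rewrite -eq_m eq_sym => neq_w.
    have [-> ->] := same _ neq_w.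
    by rewrite eqxx andbT eq_sym.
  case/andP=> + /eqP eq_m; rewrite -eq_m => neq_w.
  have [-> ->] := same _ neq_w.
  by rewrite eqxx andbT.
move=> neq_w; have [le_w gain_w] := gainE _ _ cov w.
have [le_w' gain_w'] := gainE _ _ cov' w.
have same m : ltW w (f w) m && leW w m (g w) = ltW w (f' w) m && leW w m (g' w).
  by rewrite -gain_w -gain_w'.
have lt_w : ltW w (f w) (g w) by apply: weak_neq.
have /andP[lt_1 le_1] : ltW w (f' w) (g w) && leW w (g w) (g' w).
  by rewrite -same lt_w weak_refl.
have lt_w' : ltW w (f' w) (g' w) := slin_weak_trans (linW w) lt_1 le_1.
have /andP[lt_2 le_2] : ltW w (f w) (g' w) && leW w (g' w) (g w).
  by rewrite same lt_w' weak_refl.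
split; last exact: (weak_anti (linW w)).
apply: (weak_anti (linW w)).
  rewrite -(slinN (linW w)); apply/negP => lt_f.
  by have := same (f' w); rewrite lt_f (slin_irr (linW w)) /= (weakW lt_1).
rewrite -(slinN (linW w)); apply/negP => lt_f.
by have := same (f w); rewrite lt_f (slin_irr (linW w)) /= (weakW lt_2).
Qed.

Lemma gain_sub_lower r e nu : is_rotation I r -> stable I nu -> e \in gain r ->
  (gain r \subset lower nu) = (e \in lower nu).
Proof.
case/rotationP=> mu [mu' [cov ->]] st_nu; rewrite gain_generated // => gain_e.
have [sub|dis] := covering_gain cov st_nu.
  by rewrite sub (subsetP sub).
have /negPf-> : e \notin lower nu by rewrite (disjointFr dis).
by apply: contraFF (disjointFr dis gain_e) => /subsetP->.
Qed.

(** If the gains share e, then e separates the two ends of a covering pair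
    generating one rotation, hence so does the whole gain of the other; thus
    each gain is included in the other one. *)
Lemma gain_meet_eq r r' e : is_rotation I r -> is_rotation I r' ->
  e \in gain r -> e \in gain r' -> r = r'.
Proof.
move=> rot_r rot_r' gain_e gain_e'; apply: gain_inj => //; apply/eqP.
suff sub r1 r2 : is_rotation I r1 -> is_rotation I r2 -> e \in gain r1 ->
    e \in gain r2 -> gain r1 \subset gain r2 by rewrite eqEsubset !sub.
move=> rot1 /rotationP[mu [nu [cov ->]]] gain1; rewrite gain_generated //.
have [st_mu st_nu _ _] := coveringP _ _ cov.
rewrite in_setD -(gain_sub_lower rot1 st_nu gain1) => /andP[mu'e /subsetP sub].
apply/subsetP => e1 gain1_e1; rewrite in_setD sub // andbT.
by rewrite -(gain_sub_lower rot1 st_mu gain1_e1) (gain_sub_lower rot1 st_mu gain1).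
Qed.

(** * Rotations and closed sets *)

Definition rotations_below mu : {set rotation I} :=
  [set rho | gain (val rho) \subset lower mu].

Lemma in_rotations_below rho e mu : stable I mu -> e \in gain (val rho) ->
  (rho \in rotations_below mu) = (e \in lower mu).
Proof.
by move=> st_mu gain_e; rewrite inE; apply: gain_sub_lower gain_e => //; apply: valP.
Qed.

Lemma gain_has rho : exists e, e \in gain (val rho).
Proof. exact/set0Pn/gain_neq0/valP. Qed.

Lemma rotations_below_sub mu nu :
  lower mu \subset lower nu -> rotations_below mu \subset rotations_below nu.
Proof.
by move=> le_mn; apply/subsetP => rho; rewrite !inE => /subset_trans->.
Qed.

Lemma covering_rotation mu nu : covering I mu nu ->
  exists rho : rotation I, val rho = generated_rotation mu nu.
Proof.
move=> cov; have rot : is_rotation I (generated_rotation mu nu).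
  by apply/rotationP; exists mu, nu.
by exists (exist (fun r => is_rotation I r) _ rot : rotation I).
Qed.

Lemma rotations_below_covering mu nu rho :
    covering I mu nu -> val rho = generated_rotation mu nu ->
  rho \notin rotations_below mu /\ rotations_below nu = rho |: rotations_below mu.
Proof.
move=> cov def_rho; have [st_mu st_nu /proper_sub le_mn _] := coveringP _ _ cov.
have gain_rho : gain (val rho) = lower nu :\: lower mu.
  by rewrite def_rho gain_generated.
have in_mu e : e \in gain (val rho) -> e \in lower mu = false.
  by rewrite gain_rho in_setD => /andP[/negPf].
split.
  have [e gain_e] := gain_has rho.
  by rewrite (in_rotations_below st_mu gain_e) in_mu.
apply/eqP; rewrite eqEsubset subUset rotations_below_sub // andbT.
rewrite sub1set [in X in _ && X]inE gain_rho subsetDl andbT.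
apply/subsetP => rho' nu_rho'; rewrite in_setU1 orbC.
have [e gain_e] := gain_has rho'.
rewrite (in_rotations_below st_mu gain_e); case: (boolP (e \in lower mu)) => //= mu'e.
apply/eqP/val_inj/(gain_meet_eq (valP rho') (valP rho) gain_e).
by rewrite gain_rho in_setD mu'e -(in_rotations_below st_nu gain_e).
Qed.

Lemma covering_path_exists mu nu :
    stable I mu -> stable I nu -> lower mu \subset lower nu ->
  exists2 p, path (covering I) mu p & last mu p = nu.
Proof.
have [n] := ubnP (#|lower nu| - #|lower mu|).
elim: n mu => // n IHn mu lt_n st_mu st_nu le_mn.
have [->|neq_mn] := eqVneq mu nu; first by exists [::].
pose P la := [&& stable I la, lower mu \proper lower la & lower la \subset lower nu].
have P_nu : P nu.
  rewrite /P st_nu properEneq le_mn subxx !andbT.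
  by apply: contra neq_mn => /eqP/lower_inj->.
case: (@arg_minnP _ _ P (fun la => #|lower la|) P_nu) => la.
case/and3P=> st_la lt_ml le_ln min_la.
have lt_card := proper_card lt_ml.
have [||||p path_p last_p] := IHn la => //.
  rewrite -ltnS; apply: leq_trans lt_n; rewrite ltnS ltn_sub2l //.
  exact: leq_trans lt_card (subset_leq_card le_ln).
exists (la :: p) => //=; rewrite path_p andbT; apply/coveringP; split=> // ka.
move=> st_ka le_mk le_kl; have [<-|neq_mk] := eqVneq mu ka; first by left.
right; apply: lower_inj => //; apply/eqP; rewrite eqEcard le_kl /=.
apply: min_la; rewrite /P st_ka (subset_trans le_kl) // andbT.
by rewrite properEneq le_mk andbT; apply: contra neq_mk => /eqP/lower_inj->.
Qed.

(** A covering path gains every element of the difference of its ends on some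
    arc, hence generates the rotation owning that element. *)
Lemma covering_path_generates mu p rho :
    stable I mu -> path (covering I) mu p ->
    rho \in rotations_below (last mu p) -> rho \notin rotations_below mu ->
  exists i, arc_generates mu p i rho.
Proof.
elim: p mu => [|nu p IHp] mu st_mu /=; first by move=> _ ->.
case/andP=> cov path_p; have [_ st_nu _ _] := coveringP _ _ cov.
move=> last_rho mu'rho; have [nu_rho|nu'rho] := boolP (rho \in rotations_below nu).
  have [rho1 def_rho1] := covering_rotation cov.
  have [_ below_nu] := rotations_below_covering cov def_rho1.
  move: nu_rho; rewrite below_nu in_setU1 (negPf mu'rho) orbF => /eqP->.
  by exists 0%N; rewrite /arc_generates /= def_rho1 eqxx.
have [i] := IHp _ st_nu path_p last_rho nu'rho.
rewrite /arc_generates => /andP[lt_i gen_i]; exists i.+1; rewrite /= ltnS lt_i /=.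
rewrite -(eqP gen_i); apply/eqP; congr generated_rotation.
  by apply: set_nth_default; rewrite /= ltnS ltnW.
exact: set_nth_default.
Qed.

Lemma arc_generates_catl mu p q i rho :
  arc_generates mu p i rho -> arc_generates mu (p ++ q) i rho.
Proof.
case/andP=> lt_i gen_i; rewrite /arc_generates size_cat ltn_addr //=.
by rewrite -cat_cons nth_cat /= ltnS ltnW // nth_cat lt_i.
Qed.

Lemma arc_generates_catr mu p q i rho : arc_generates (last mu p) q i rho ->
  arc_generates mu (p ++ q) (size p + i) rho.
Proof.
case/andP=> lt_i gen_i; rewrite /arc_generates size_cat ltn_add2l lt_i /=.
have nthE j : (j < size (last mu p :: q))%N ->
    nth mu (mu :: p ++ q) (size p + j) = nth (last mu p) (last mu p :: q) j.
  move=> lt_j; rewrite -cat_cons lastI cat_rcons nth_cat size_belast.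
  by rewrite ltnNge leq_addr addKn; apply: set_nth_default.
rewrite -[nth mu (p ++ q) _]/(nth mu (mu :: p ++ q) (size p + i).+1) -addnS.
by rewrite !nthE // ltnW.
Qed.

End RingOfSets.

Section ClosedSets.

Variables (M W : finType) (I : marriage_instance M W).

Implicit Types (mu nu : {set M * W}) (rho : rotation I).

Lemma rotations_below_min mu0 :
  is_min_stable I mu0 -> rotations_below I mu0 = set0.
Proof.
move=> min_mu0; have [st_mu0 le_mu0] := min_stableP min_mu0.
apply/setP => rho; rewrite in_set0; apply/negbTE.
have /rotationP[la [ka [cov def_rho]]] := valP rho.
have [st_la _ _ _] := coveringP _ _ _ cov.
have [+ _] := rotations_below_covering cov def_rho.
by apply: contra; apply/subsetP/rotations_below_sub/le_mu0.
Qed.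

Lemma rotations_below_max muz rho :
  is_max_stable I muz -> rho \in rotations_below I muz.
Proof.
move=> max_muz; have [st_muz le_muz] := max_stableP max_muz.
have /rotationP[la [ka [cov def_rho]]] := valP rho.
have [_ st_ka _ _] := coveringP _ _ _ cov.
have [_ below_ka] := rotations_below_covering cov def_rho.
apply: (subsetP (rotations_below_sub (le_muz _ st_ka))).
by rewrite below_ka setU11.
Qed.

(** A maximal path through mu generates the rotations below mu before reaching
    mu and all the others after, so that a rotation outside of the set does not
    precede one inside. *)
Lemma rotations_below_closed mu rho rho' : stable I mu ->
  precedes rho rho' -> rho' \in rotations_below I mu -> rho \in rotations_below I mu.
Proof.
move=> st_mu prec mu_rho'; apply: contraT => mu'rho.
have [mu0 min_mu0] := stable_min_exists I.
have [muz max_muz] := stable_max_exists I.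
have [st_mu0 le_mu0] := min_stableP min_mu0.
have [st_muz le_muz] := max_stableP max_muz.
have [p path_p last_p] := covering_path_exists st_mu0 st_mu (le_mu0 _ st_mu).
have [q path_q last_q] := covering_path_exists st_mu st_muz (le_muz _ st_mu).
have [j gen_j] : exists j, arc_generates mu0 p j rho'.
  by apply: covering_path_generates; rewrite ?last_p // rotations_below_min ?in_set0.
have [i gen_i] : exists i, arc_generates mu q i rho.
  by apply: covering_path_generates; rewrite ?last_q // rotations_below_max.
have path_pq : path (covering I) mu0 (p ++ q) by rewrite cat_path path_p last_p.
have last_pq : last mu0 (p ++ q) = muz by rewrite last_cat last_p.
have gen_i' : arc_generates mu0 (p ++ q) (size p + i) rho.
  by apply: arc_generates_catr; rewrite last_p.
have := prec _ _ _ min_mu0 max_muz path_pq last_pq _ _ gen_i'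
  (arc_generates_catl q gen_j).
have /andP[lt_j _] := gen_j.
by move=> /leq_ltn_trans/(_ lt_j)/ltnW; rewrite ltnNge leq_addr.
Qed.

(** Let nu be the least stable matching above rho.  On a maximal path, the arc
    generating rho ends above nu, so the other rotations below nu have been
    generated before. *)
Lemma least_above_rotation rho : exists nu,
  [/\ stable I nu, rho \in rotations_below I nu &
      forall rho', rho' \in rotations_below I nu -> rotation_le I rho' rho].
Proof.
pose P nu := stable I nu && (rho \in rotations_below I nu).
have [nu1 P_nu1] : exists nu, P nu.
  have /rotationP[la [ka [cov def_rho]]] := valP rho; exists ka.
  have [_ st_ka _ _] := coveringP _ _ _ cov; rewrite /P st_ka.
  by have [_ ->] := rotations_below_covering cov def_rho; rewrite setU11.
case: (@arg_minnP _ _ P (fun la => #|lower I la|) P_nu1) => nu.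
case/andP=> st_nu nu_rho min_nu; exists nu; split=> // rho' nu_rho'.
have least la : stable I la -> rho \in rotations_below I la ->
    lower I nu \subset lower I la.
  move=> st_la la_rho; have [ka st_ka low_ka] := stable_meet st_nu st_la.
  apply/setIidPl/eqP; rewrite eqEcard subsetIl -low_ka min_nu //.
  by rewrite /P st_ka inE low_ka subsetI; move: nu_rho la_rho; rewrite !inE => -> ->.
have [->|neq_rho] := eqVneq rho' rho; first by left.
right=> mu0 muz p min_mu0 _ path_p _ i j gen_i gen_j.
pose x k := nth mu0 (mu0 :: p) k.
have cov k : (k < size p)%N -> covering I (x k) (x k.+1).
  exact: (pathP mu0 path_p).
have mono k l : (k <= l <= size p)%N -> lower I (x k) \subset lower I (x l).
  elim: l => [|l IHl] /andP[]; first by rewrite leqn0 => /eqP->.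
  rewrite leq_eqVlt => /predU1P[->//|le_kl] lt_l.
  apply: subset_trans (IHl _) _; first by rewrite -ltnS le_kl ltnW.
  by have [_ _ /proper_sub] := coveringP _ _ _ (cov l lt_l).
have /andP[lt_i /eqP/esym def_rho'] := gen_i.
have /andP[lt_j /eqP/esym def_rho] := gen_j.
have [_ st_j _ _] := coveringP _ _ _ (cov j lt_j).
have [_ below_j] := rotations_below_covering (cov j lt_j) def_rho.
have xj_rho' : rho' \in rotations_below I (x j.+1).
  apply: (subsetP (rotations_below_sub (least _ st_j _))) => //.
  by rewrite below_j setU11.
have [xi'rho' _] := rotations_below_covering (cov i lt_i) def_rho'.
rewrite ltn_neqAle; apply/andP; split.
  apply: contra neq_rho => /eqP eq_ij; apply/eqP/val_inj.
  by rewrite def_rho' def_rho eq_ij.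
rewrite leqNgt; apply: contra xi'rho' => lt_ji.
by apply: (subsetP (rotations_below_sub (mono _ _ _)) _ xj_rho'); rewrite lt_ji ltnW.
Qed.

(** A closed set U is the set of rotations below the join of the least stable
    matchings above its elements. *)
Lemma closed_rotations_below (U : {set rotation I}) :
    (forall rho rho', precedes rho rho' -> rho' \in U -> rho \in U) ->
  exists2 mu, stable I mu & rotations_below I mu = U.
Proof.
move=> closedU; have [mu0 min_mu0] := stable_min_exists I.
have [st_mu0 le_mu0] := min_stableP min_mu0.
have /fin_all_exists[J JP] := least_above_rotation.
have stJ : all (stable I) [seq J rho | rho <- enum U].
  by apply/allP => _ /mapP[rho _ ->]; case: (JP rho).
have [mu st_mu low_mu] := stable_bigjoin st_mu0 stJ; exists mu => //.
apply/setP => rho; have [e gain_e] := gain_has rho.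
rewrite (in_rotations_below st_mu gain_e) low_mu /= has_map.
rewrite -(in_rotations_below st_mu0 gain_e) rotations_below_min // in_set0 /=.
apply/hasP/idP => [[rho' /=]|U_rho].
  rewrite mem_enum => U_rho'; have [st_J _ le_J] := JP rho'.
  rewrite -(in_rotations_below st_J gain_e) => /le_J[->//|prec].
  exact: closedU prec U_rho'.
exists rho; first by rewrite mem_enum.
by have [st_J J_rho _] := JP rho; rewrite /= -(in_rotations_below st_J gain_e).
Qed.

End ClosedSets.

(** * Convex hulls *)

Local Open Scope classical_set_scope.
Local Open Scope ring_scope.

Section ConvexHull.

Variable R : realFieldType.

Implicit Types U V : lmodType R.

(** Points of weight zero may lie outside X, so that a family indexed by all
    the subsets of a poset can be used when only the closed ones are in X. *)
Lemma convex_hull_fin V (X : set V) (T : finType) (l : T -> R) (x : T -> V) :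
    (forall t, 0 <= l t) -> \sum_t l t = 1 -> (forall t, l t != 0 -> X (x t)) ->
  convex_hull X (\sum_t l t *: x t).
Proof.
move=> l_ge0 sum_l Xx; pose A := [pred t | l t != 0].
exists #|A|, (fun i => l (enum_val i)), (fun i => x (enum_val i)).
have supp (V' : nmodType) (F : T -> V') : (forall t, l t = 0 -> F t = 0) ->
    \sum_t F t = \sum_(i < #|A|) F (enum_val i).
  move=> F0; rewrite -(big_enum_val F) /= [LHS](bigID A) /=.
  by rewrite [X in _ + X]big1 ?addr0 // => t /negPn/eqP/F0.
split=> [i||i|] //.
- by rewrite -(supp _ l).
- by apply: Xx; apply: (enum_valP i).
- by rewrite -(supp _ (fun t => l t *: x t)) // => t ->; rewrite scale0r.
Qed.

Lemma affine_map_comb U V (f : U -> V) k (l : 'I_k -> R) (x : 'I_k -> U) :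
  affine_map f -> \sum_i l i = 1 -> f (\sum_i l i *: x i) = \sum_i l i *: f (x i).
Proof.
case=> g [b fE] sum_l; rewrite fE linear_sum.
under [RHS]eq_bigr do rewrite fE scalerDr.
rewrite big_split /= -scaler_suml sum_l scale1r; congr (b + _).
by apply: eq_bigr => i _; rewrite linearZ.
Qed.

Lemma affine_convex_hull U V (X : set U) (Y : set V) (f : U -> V) u :
    affine_map f -> (forall x, X x -> Y (f x)) ->
  convex_hull X u -> convex_hull Y (f u).
Proof.
move=> aff_f fXY [k [l [x [l_ge0 sum_l Xx ->]]]].
exists k, l, (f \o x); split=> // [i|]; first exact/fXY/Xx.
exact: affine_map_comb.
Qed.

Lemma affine_convex_hull_id U V (X : set U) (f : U -> V) (h : V -> U) u :
    affine_map f -> affine_map h -> (forall x, X x -> h (f x) = x) ->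
  convex_hull X u -> h (f u) = u.
Proof.
move=> aff_f aff_h hfK [k [l [x [l_ge0 sum_l Xx ->]]]].
rewrite (affine_map_comb x aff_f) // (affine_map_comb _ aff_h) //.
by apply: eq_bigr => i _; rewrite hfK.
Qed.

(** Affine maps commute with convex combinations, so what holds on the
    generators extends to the hulls. *)
Lemma convex_hull_bij U V (X : set U) (Y : set V) (f : U -> V) (h : V -> U) :
    affine_map f -> affine_map h ->
    (forall x, X x -> Y (f x)) -> (forall y, Y y -> X (h y)) ->
    (forall x, X x -> h (f x) = x) -> (forall y, Y y -> f (h y) = y) ->
  set_bij (convex_hull X) (convex_hull Y) f /\
  convex_hull X = [set h y | y in convex_hull Y].
Proof.
move=> aff_f aff_h fXY hYX fK hK.
have fKhull u := @affine_convex_hull_id _ _ X f h u aff_f aff_h fK.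
have hKhull v := @affine_convex_hull_id _ _ Y h f v aff_h aff_f hK.
have fhull u := @affine_convex_hull _ _ X Y f u aff_f fXY.
have hhull v := @affine_convex_hull _ _ Y X h v aff_h hYX.
split; first split.
- by move=> u /fhull.
- by move=> u v /set_mem Xu /set_mem Xv eq_f; rewrite -(fKhull u Xu) eq_f fKhull.
- by move=> v Yv; exists (h v); [apply: hhull | apply: hKhull].
apply/seteqP; split=> [u Xu|_ [v Yv <-]]; last exact: hhull.
by exists (f u); [apply: fhull | apply: fKhull].
Qed.

End ConvexHull.

(** * Order polytopes *)

Section OrderPolytope.

Variables (R : realFieldType) (P : finType) (le : P -> P -> Prop).

Definition down_closed (U : {set P}) : Prop :=
  forall i j, le i j -> j \in U -> i \in U.

(** The layer-cake decomposition: the support of x is closed, and subtracting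
    its least nonzero value from x on the support shrinks the support.  The
    bound c is the total weight of the layers: what the nonempty ones leave is
    the weight of the empty set. *)
Lemma monotone_layers (c : R) (x : {ffun P -> R^o}) :
    (forall i, 0 <= x i <= c) -> 0 <= c -> (forall i j, le i j -> x j <= x i) ->
  exists l : {set P} -> R,
    [/\ forall U, 0 <= l U, \sum_U l U = c, forall U, l U != 0 -> down_closed U
      & x = \sum_U l U *: char_vec R U].
Proof.
have [n] := ubnP #|[pred i | x i != 0]|.
elim: n c x => // n IHn c x lt_n x_bd c_ge0 x_mono.
have [/existsP[i0 x_i0]|/existsPn x0] := boolP [exists i, x i != 0]; last first.
  exists (fun U => (U == finset.set0)%:R * c); split=> [U||U|].
  - by rewrite mulr_ge0 ?ler0n.
  - rewrite (bigD1 finset.set0) //= eqxx mul1r big1 ?addr0 // => U /negPf->.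
    by rewrite mul0r.
  - by case: (eqVneq U finset.set0) => [-> _ i j _|_]; rewrite ?in_set0 ?mul0r ?eqxx.
  apply/ffunP => i; rewrite sum_ffunE big1 => [|U _].
    by apply/eqP/negPn; exact: x0.
  rewrite !ffunE; case: eqP => [->|_]; last by rewrite mul0r scale0r.
  by rewrite in_set0 scaler0.
have x_ge0 i : 0 <= x i by case/andP: (x_bd i).
case: (@arg_minP _ _ _ i0 [pred i | x i != 0] x x_i0) => i1 /= x_i1 min_i1.
pose m := x i1; pose S : {set P} := [set i | x i != 0]%SET.
have m_gt0 : 0 < m by rewrite lt0r x_i1 x_ge0.
have closedS : down_closed S.
  move=> i j le_ij; rewrite !inE => x_j; rewrite gt_eqF //.
  by apply: lt_le_trans (x_mono _ _ le_ij); rewrite lt0r x_j x_ge0.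
pose x' : {ffun P -> R^o} := x - m *: char_vec R S.
have x'E i : x' i = x i - m * (i \in S)%:R by rewrite !ffunE.
have m_le_c : m <= c by case/andP: (x_bd i1).
have [||||l [l_ge0 sum_l closed_l x'_l]] := IHn (c - m) x'.
- rewrite -ltnS; apply: leq_trans lt_n; rewrite ltnS; apply/proper_card/properP.
  split; last by exists i1; rewrite ?inE // x'E !inE x_i1 mulr1 subrr eqxx.
  apply/subsetP => i; rewrite !inE x'E inE; apply: contraNN => /eqP->.
  by rewrite eqxx mulr0 subr0.
- move=> i; rewrite x'E inE; have [x_i|x_i] /= := eqVneq (x i) 0.
    by rewrite x_i mulr0 subr0 lexx subr_ge0.
  by rewrite mulr1 lerD2r subr_ge0 min_i1 //=; case/andP: (x_bd i).
- by rewrite subr_ge0.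
- move=> i j le_ij; rewrite !x'E.
  have [Sj|Sj] := boolP (j \in S).
    by rewrite (closedS _ _ le_ij Sj) lerD2r x_mono.
  have -> : x j = 0 by move: Sj; rewrite inE negbK => /eqP.
  rewrite mulr0 subr0 inE; have [->|x_i] /= := eqVneq (x i) 0.
    by rewrite mulr0 subr0.
  by rewrite mulr1 subr_ge0 min_i1.
exists (fun U => l U + (U == S)%:R * m); split=> [U||U|].
- by rewrite addr_ge0 // mulr_ge0 ?ler0n // ltW.
- rewrite big_split /= sum_l (bigD1 S) //= eqxx mul1r big1 => [|U /negPf->].
    by rewrite addr0 subrK.
  by rewrite mul0r.
- by case: (eqVneq U S) => [->//|_]; rewrite mul0r addr0; apply: closed_l.
under eq_bigr do rewrite scalerDl.
rewrite big_split /= -x'_l (bigD1 S) //= eqxx mul1r big1 => [|U /negPf->].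
  by rewrite addr0 subrK.
by rewrite mul0r scale0r.
Qed.

(** With the bound 1 on its values, the layers of x form a convex
    combination. *)
Lemma order_polytope_hull :
  order_polytope R le = convex_hull [set char_vec R U | U in down_closed].
Proof.
apply/seteqP; split=> [x [x01 x_mono]|_ [k [l [x [l_ge0 sum_l Xx ->]]]]].
  have [l [l_ge0 sum_l closed_l ->]] := monotone_layers x01 ler01 x_mono.
  by apply: convex_hull_fin => // U /closed_l; exists U.
have valE i : (\sum_t l t *: x t) i = \sum_t l t * x t i.
  by rewrite sum_ffunE; apply: eq_bigr => t _; rewrite !ffunE.
have x01 t i : 0 <= x t i <= 1.
  by have [U _ <-] := Xx t; rewrite ffunE ler0n lern1 leq_b1.
split=> [i|i j le_ij]; rewrite !valE.
  rewrite sumr_ge0 => [/=|t _]; last by rewrite mulr_ge0 //; case/andP: (x01 t i).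
  rewrite -[leRHS]sum_l ler_sum // => t _.
  by rewrite ler_piMr //; case/andP: (x01 t i).
apply: ler_sum => t _; apply: ler_wpM2l => //.
have [U closedU <-] := Xx t; rewrite !ffunE ler_nat.
by case: (boolP (j \in U)) => [/(closedU _ _ le_ij)->|].
Qed.

End OrderPolytope.

(** * The affine equivalence *)

Section AffineEquivalence.

Variables (R : realFieldType) (M W : finType) (I : marriage_instance M W).

Implicit Types (mu nu : {set M * W}) (rho : rotation I).

Definition marker rho : M * W := xchoose (gain_has rho).

(** In a stable matching exactly one edge at the woman of the marker has weight
    1, and that edge is in the sum when the marker is in the lower set, that is,
    when rho is below the matching. *)
Definition threshold (x : {ffun M * W -> R^o}) : {ffun rotation I -> R^o} :=
  [ffun rho => \sum_(e | (e.2 == (marker rho).2)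
                        && weak (Defs.ltW I e.2) (marker rho).1 e.1) x e].

Lemma threshold_linear : linear threshold.
Proof.
move=> a x y; apply/ffunP => rho; rewrite !ffunE scaler_sumr -big_split /=.
by apply: eq_bigr => e _; rewrite !ffunE.
Qed.

HB.instance Definition _ :=
  GRing.isLinear.Build R _ _ _ threshold threshold_linear.

Lemma matrix_apply_linear (E P : finType) (A : E -> P -> R) :
  linear (matrix_apply A).
Proof.
move=> a x y; apply/ffunP => e; rewrite !ffunE scaler_sumr -big_split /=.
by apply: eq_bigr => rho _; rewrite !ffunE mulrDr; congr (_ + _); exact: mulrCA.
Qed.

HB.instance Definition _ (E P : finType) (A : E -> P -> R) :=
  GRing.isLinear.Build R _ _ _ (matrix_apply A) (matrix_apply_linear A).

Lemma threshold_char_vec mu : stable I mu ->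
  threshold (char_vec R mu) = char_vec R (rotations_below I mu).
Proof.
move=> st_mu; apply/ffunP => rho; rewrite !ffunE.
rewrite (in_rotations_below st_mu (xchooseP (gain_has rho))) -/(marker rho).
have [f st_f ->] := stable_graphP st_mu; rewrite in_lower_graph.
case: (marker rho) => m w /=; rewrite big_mkcond (bigD1 (f w, w)) //= !ffunE inE.
rewrite !eqxx /= big1 ?addr0; first by case: ifP.
move=> [m' w'] neq_e /=; rewrite ffunE inE /=.
case: eqP => // eq_w; case: ifP => // _; case: eqP => // eq_m.
by rewrite -eq_m eq_w eqxx in neq_e.
Qed.

(** Crossing the arc adds the one rotation that it generates, and the column of
    A at that rotation is the difference of the two matchings. *)
Lemma char_vec_covering mu nu : covering I mu nu ->
  char_vec R nu = char_vec R mu + matrix_apply (rotation_matrix R I)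
    (char_vec R (rotations_below I nu) - char_vec R (rotations_below I mu)).
Proof.
move=> cov; have [rho def_rho] := covering_rotation cov.
have [mu'rho ->] := rotations_below_covering cov def_rho.
apply/ffunP => e; rewrite !ffunE (bigD1 rho) //= big1 => [|rho' neq_rho].
  rewrite /rotation_matrix !ffunE in_setU1 eqxx (negPf mu'rho) def_rho /=.
  rewrite !in_setD subr0 mulr1 addr0.
  by case: (e \in nu) (e \in mu) => [] [] /=; rewrite ?subrr ?addr0 ?add0r ?subr0 ?addrN.
by rewrite !ffunE in_setU1 (negPf neq_rho) subrr mulr0.
Qed.

Lemma char_vec_path mu p : path (covering I) mu p ->
  char_vec R (last mu p) = char_vec R mu + matrix_apply (rotation_matrix R I)
    (char_vec R (rotations_below I (last mu p)) - char_vec R (rotations_below I mu)).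
Proof.
elim: p mu => [|nu p IHp] mu /=; first by rewrite subrr linear0 addr0.
case/andP=> cov /IHp->; rewrite (char_vec_covering cov) -addrA -linearD.
by congr (_ + matrix_apply _ _); rewrite addrC addrA subrK.
Qed.

Lemma char_vec_rotations mu0 mu : is_min_stable I mu0 -> stable I mu ->
  char_vec R mu = char_vec R mu0
    + matrix_apply (rotation_matrix R I) (char_vec R (rotations_below I mu)).
Proof.
move=> min_mu0 st_mu; have [st_mu0 le_mu0] := min_stableP min_mu0.
have [p path_p last_p] := covering_path_exists st_mu0 st_mu (le_mu0 _ st_mu).
have := char_vec_path path_p; rewrite last_p => {1}->.
congr (_ + matrix_apply _ _); rewrite (rotations_below_min min_mu0).
by apply/ffunP => rho; rewrite !ffunE in_set0 subr0.
Qed.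

Lemma down_closed_rotations (U : {set rotation I}) :
  down_closed (rotation_le I) U <->
  exists2 mu, stable I mu & rotations_below I mu = U.
Proof.
split=> [closedU|[mu st_mu <-] rho rho' [->//|]].
  by apply: closed_rotations_below => rho rho' prec; apply: closedU; right.
exact: rotations_below_closed.
Qed.

End AffineEquivalence.

Theorem theorem18 (R : realFieldType) (M W : finType)
    (I : marriage_instance M W) :
  affinely_equivalent (stable_matching_polytope R I)
    (order_polytope R (rotation_le I))
  /\ forall mu0 : {set M * W}, is_min_stable I mu0 ->
     stable_matching_polytope R I =
       [set char_vec R mu0 + matrix_apply (rotation_matrix R I) x
         | x in order_polytope R (rotation_le I)].
Proof.
suff equiv mu0 : is_min_stable I mu0 ->
    set_bij (stable_matching_polytope R I) (order_polytope R (rotation_le I))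
            (@threshold R _ _ I) /\
    stable_matching_polytope R I =
      [set char_vec R mu0 + matrix_apply (rotation_matrix R I) x
        | x in order_polytope R (rotation_le I)].
  split=> [|mu0 /equiv[]//]; have [mu0 /equiv[bij_thr _]] := stable_min_exists I.
  exists (@threshold R _ _ I) => //.
  by exists (@threshold R _ _ I), 0 => x; rewrite add0r.
move=> min_mu0; rewrite order_polytope_hull.
apply: convex_hull_bij.
- by exists (@threshold R _ _ I), 0 => x; rewrite add0r.
- by exists (matrix_apply (rotation_matrix R I)), (char_vec R mu0).
- move=> _ [mu st_mu <-]; exists (rotations_below I mu).
    by apply/down_closed_rotations; exists mu.
  by rewrite threshold_char_vec.
- move=> _ [U /down_closed_rotations[mu st_mu <-] <-]; exists mu => //.
  exact: char_vec_rotations.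
- by move=> _ [mu st_mu <-]; rewrite threshold_char_vec // -char_vec_rotations.
- move=> _ [U /down_closed_rotations[mu st_mu <-] <-].
  by rewrite -char_vec_rotations // threshold_char_vec.
Qed.
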